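(* Let $(K,\nu)$ be a valued field and $\omega$ a valuation transcendental extension of $\nu$ to $K(x)$. Take two extensions $\overline{\omega}$ and $\overline{\omega'}$ of $\omega$ to $\overline{K}(x)$ with minimal pairs of definition $(a,\gamma)$ and $(a',\gamma)$ respectively. Then $$(\overline{\omega}K(a):\nu K)=(\overline{\omega'}K(a'):\nu K)\quad\text{and}\quad K(a)\overline{\omega}=K(a')\overline{\omega'}.$$
   Context: Values are written additively, $\nu 0=\infty$; for a valued field $(L,\nu)$, $\nu L$ and $L\nu$ denote the value group and residue field. $\overline{K}$ is a fixed algebraic closure of $K$ and $K(x)\subseteq\overline{K}(x)$ are rational function fields. An extension $\omega$ of $\nu$ to $K(x)$ is value transcendental if $\dim_{\mathbb{Q}}\big((\omega K(x)/\nu K)\otimes_{\mathbb{Z}}\mathbb{Q}\big)=1$, residue transcendental if $\mathrm{trdeg}[K(x)\omega:K\nu]=1$, and valuation transcendental if it is one of these. Given an extension $\overline{\omega}$ of $\omega$ to $\overline{K}(x)$, let $\overline{\nu}=\overline{\omega}|_{\overline{K}}$. For $a\in\overline{K}$ and $\gamma$ in an ordered abelian group containing $\overline{\nu}\,\overline{K}$, $\overline{\nu}_{a,\gamma}$ is the valuation on $\overline{K}(x)$ determined by $\overline{\nu}_{a,\gamma}\big(\sum_i c_i(x-a)^i\big)=\min_i\{\overline{\nu}c_i+i\gamma\}$ ($c_i\in\overline{K}$). A pair $(a,\gamma)$ with $a\in\overline{K}$, $\gamma\in\overline{\omega}\,\overline{K}(x)$ is a pair of definition for $\overline{\omega}$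 if $\overline{\omega}=\overline{\nu}_{a,\gamma}$; it is a minimal pair of definition if moreover for every $b\in\overline{K}$, $\overline{\nu}(a-b)\geq\gamma$ implies $[K(a):K]\leq[K(b):K]$. Conventions: value groups of extensions of $\omega$ to $\overline{K}(x)$ are regarded as subgroups of the divisible hull of $\omega K(x)$. The residue field $K(x)\omega$ embeds canonically in the residue fields of $\overline{\omega}$ and of $\overline{\omega'}$; the residue fields $K(a)\overline{\omega}$ and $K(a')\overline{\omega'}$ are compared via this identification, as subfields of $K(x)\omega$. *)

(* Defs.v *)
From HB Require Import structures.
From mathcomp Require Import all_boot all_order all_algebra.
From mathcomp Require Import mathcomp_extra boolp classical_sets functions.
From mathcomp Require Import cardinality.

Set Implicit Arguments.
Unset Strict Implicit.
Unset Printing Implicit Defensive.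

Import Order.TTheory GRing.Theory.
Local Open Scope ring_scope.

HB.mixin Record isOrderedZmodule G of Num.POrderedZmodule G := {
  oz_le_total : total (<=%R : rel G);
  oz_leD2l : forall x y z : G, x <= y -> z + x <= z + y
}.

#[short(type="orderedZmodType")]
HB.structure Definition OrderedZmodule :=
  {G of isOrderedZmodule G & Num.POrderedZmodule G}.

Definition vinf (G : Type) := option G.
Definition Fin {G : Type} (g : G) : vinf G := Some g.
Definition Infty {G : Type} : vinf G := None.

HB.instance Definition _ (G : choiceType) := Choice.on (vinf G).

Section Vinf.
Variable G : orderedZmodType.
Implicit Types u v w : vinf G.

Definition vinf_le u v : bool :=
  match u, v with
  | _, None => true
  | None, Some _ => false
  | Some g, Some h => g <= h
  end.

Definition vinf_add u v : vinf G :=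
  match u, v with
  | Some g, Some h => Some (g + h)
  | _, _ => None
  end.

Fact vinf_le_refl : reflexive vinf_le.
Proof. by case=> [g|] /=. Qed.

Fact vinf_le_anti : antisymmetric vinf_le.
Proof. by case=> [g|] [h|] //= /le_anti ->. Qed.

Fact vinf_le_trans : transitive vinf_le.
Proof. by case=> [g|] [h|] [k|] //=; apply: le_trans. Qed.

HB.instance Definition _ := Order.Le_isPOrder.Build ring_display (vinf G)
  vinf_le_refl vinf_le_anti vinf_le_trans.

Fact vinf_le_total : total (<=%O : rel (vinf G)).
Proof. by case=> [g|] [h|] //; apply: oz_le_total. Qed.

HB.instance Definition _ :=
  Order.POrder_isTotal.Build ring_display (vinf G) vinf_le_total.

Fact vinf_addA : associative vinf_add.
Proof. by case=> [g|] [h|] [k|] //=; rewrite addrA. Qed.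

Fact vinf_addC : commutative vinf_add.
Proof. by case=> [g|] [h|] //=; rewrite addrC. Qed.

Fact vinf_add0 : left_id (Fin 0) vinf_add.
Proof. by case=> [g|] //=; rewrite add0r. Qed.

HB.instance Definition _ :=
  GRing.isNmodule.Build (vinf G) vinf_addA vinf_addC vinf_add0.

Lemma vinf0E : 0 = Fin 0 :> vinf G. Proof. by []. Qed.
Lemma FinD (g h : G) : Fin g + Fin h = Fin (g + h). Proof. by []. Qed.
Lemma InftyD u : Infty + u = Infty. Proof. by []. Qed.
Lemma lefE (g h : G) : (Fin g <= Fin h) = (g <= h). Proof. by []. Qed.
Lemma le_Infty u : u <= Infty. Proof. by case: u. Qed.
Lemma Fin_inj : injective (@Fin G). Proof. by move=> g h []. Qed.

Lemma ltfE (g h : G) : (Fin g < Fin h) = (g < h).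
Proof. by rewrite !lt_neqAle lefE (inj_eq Fin_inj). Qed.

Lemma lt_Infty (g : G) : Fin g < Infty.
Proof. by rewrite lt_neqAle le_Infty andbT; apply/eqP. Qed.

Lemma oz_leD (a b c d : G) : a <= b -> c <= d -> a + c <= b + d.
Proof.
move=> ab cd; apply: (@le_trans _ _ (a + d)); first exact: oz_leD2l.
by rewrite addrC (addrC b); apply: oz_leD2l.
Qed.

Lemma oz_ltD (a b c d : G) : a < b -> c <= d -> a + c < b + d.
Proof.
move=> ab cd; rewrite lt_neqAle oz_leD ?(ltW ab) // andbT.
apply/eqP => e; have : b + d <= a + d by rewrite -e; apply: oz_leD2l.
move=> /(fun i => oz_leD2l _ _ (- d) i); rewrite (addrC b) (addrC a) !addKr.
by move=> ba; have := lt_le_trans ab ba; rewrite ltxx.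
Qed.

Lemma vinf_addr_ge0 u v : Fin 0 <= u -> Fin 0 <= v -> Fin 0 <= u + v.
Proof.
case: u v => [g|] [h|] // g0 h0; have := @oz_leD 0 g 0 h g0 h0.
by rewrite addr0.
Qed.

Lemma vinf_addr_gt0 u v : Fin 0 < u -> Fin 0 <= v -> Fin 0 < u + v.
Proof.
case: u v => [g|] [h|] //; rewrite ltfE lefE FinD ltfE => g0 h0.
by have := @oz_ltD 0 g 0 h g0 h0; rewrite addr0.
Qed.

End Vinf.

Record valuation (L : fieldType) (G : orderedZmodType) := Valuation {
  val_fun :> L -> vinf G;
  valuation_eqInfty : forall x, val_fun x = Infty <-> x = 0;
  valuationM : forall x y, val_fun (x * y) = val_fun x + val_fun y;
  valuationD : forall x y, Order.min (val_fun x) (val_fun y) <= val_fun (x + y)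
}.

Section ValuationTheory.
Variables (L : fieldType) (G : orderedZmodType) (v : valuation L G).

Lemma valuation0 : v 0 = Infty. Proof. exact/valuation_eqInfty. Qed.

Lemma val_Fin x : x != 0 -> exists g, v x = Fin g.
Proof.
move=> /eqP x0; case E: (v x) => [g|]; first by exists g.
by case: x0; apply/(valuation_eqInfty v).
Qed.

Lemma Fin_val_neq0 x g : v x = Fin g -> x != 0.
Proof. by move=> vx; apply/eqP => x0; rewrite x0 valuation0 in vx. Qed.

Lemma valuation1 : v 1 = Fin 0.
Proof.
have [g vg] := val_Fin (oner_neq0 L).
have := valuationM v 1 1; rewrite mulr1 vg FinD => /Fin_inj.
by rewrite -[LHS]addr0 => /addrI <-.
Qed.

Lemma valuationV x g : v x = Fin g -> v x^-1 = Fin (- g).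
Proof.
move=> vx; have x0 := Fin_val_neq0 vx.
have [h vh] : exists h, v x^-1 = Fin h by apply: val_Fin; rewrite invr_eq0.
have := valuationM v x x^-1; rewrite mulfV // valuation1 vx vh FinD => /Fin_inj e.
by congr Fin; rewrite -[h](addKr g) -e addr0.
Qed.

Lemma valuationN x : v (- x) = v x.
Proof.
have N1 : v (-1) = Fin 0.
  have [g vg] : exists g, v (-1) = Fin g.
    by apply: val_Fin; rewrite oppr_eq0 oner_neq0.
  have := valuationM v (-1) (-1); rewrite mulrNN mulr1 valuation1 vg FinD => /Fin_inj gg.
  congr Fin; apply/le_anti.
  have /orP[g0|g0] := oz_le_total 0 g; rewrite g0 ?andbT /= gg.
    by rewrite -[leLHS]addr0; apply: oz_leD2l.
  by rewrite -[leRHS]addr0; apply: oz_leD2l.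
by rewrite -mulN1r valuationM N1 add0r.
Qed.

End ValuationTheory.

(* All the value groups are taken inside one ordered group [G], so that an
   extension restricts to the given valuation on the nose. *)
Definition extends (L M : fieldType) (G : orderedZmodType)
    (j : {rmorphism L -> M}) (v : valuation L G) (w : valuation M G) : Prop :=
  forall x, w (j x) = v x.

Section Restriction.
Variables (L M : fieldType) (G : orderedZmodType) (j : {rmorphism L -> M}).
Variable w : valuation M G.

Fact restr_eqInfty x : w (j x) = Infty <-> x = 0.
Proof.
split=> [/(valuation_eqInfty w)/eqP|->]; first by rewrite fmorph_eq0 => /eqP.
by rewrite rmorph0 valuation0.
Qed.

Fact restrM x y : w (j (x * y)) = w (j x) + w (j y).
Proof. by rewrite rmorphM valuationM. Qed.

Fact restrD x y : Order.min (w (j x)) (w (j y)) <= w (j (x + y)).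
Proof. by rewrite rmorphD valuationD. Qed.

Definition restr : valuation L G := Valuation restr_eqInfty restrM restrD.

Lemma extends_restr : extends j restr w. Proof. by []. Qed.

End Restriction.

Section ValueGroup.
Variables (L : fieldType) (G : orderedZmodType) (v : valuation L G).

Definition in_value_group : pred G := fun g => `[< exists x, v x = Fin g >].

Fact value_group_closed : zmod_closed in_value_group.
Proof.
split; first by apply/asboolP; exists 1; rewrite valuation1.
move=> g h /asboolP[x vx] /asboolP[y vy]; apply/asboolP; exists (x / y).
by rewrite valuationM vx (valuationV vy) FinD.
Qed.

HB.instance Definition _ :=
  GRing.isZmodClosed.Build G in_value_group value_group_closed.

Definition value_group := {g : G | in_value_group g}.
HB.instance Definition _ := Choice.on value_group.
HB.instance Definition _ := [isSub of value_group for @sval _ _].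
HB.instance Definition _ := [SubChoice_isSubZmodule of value_group by <:].

(* [G] is the divisible hull of the value group of [v]; torsion-freeness is
   automatic since [G] is ordered. *)
Definition is_divisible_hull : Prop :=
  (forall (g : G) n, (0 < n)%N -> exists h, h *+ n = g) /\
  (forall g : G, exists2 n, (0 < n)%N & g *+ n \in in_value_group).

End ValueGroup.

(* The quotient of the value group of [w] by that of [v]; it is only used when
   [w] extends [v], so that the latter is a subgroup of the former. *)
Section ValueQuotient.
Variables (L M : fieldType) (G : orderedZmodType).
Variables (w : valuation M G) (v : valuation L G).

Definition in_sub_value_group : pred (value_group w) :=
  fun g => val g \in in_value_group v.

Fact sub_value_group_closed : zmod_closed in_sub_value_group.
Proof.
split; first by have : 0 \in in_value_group v by apply: rpred0.
move=> g h hg hh.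
by have : val g - val h \in in_value_group v by apply: rpredB.
Qed.

HB.instance Definition _ := GRing.isZmodClosed.Build
  (value_group w) in_sub_value_group sub_value_group_closed.

Definition value_quotient : zmodType :=
  Quotient.quot (GRing.ZmodClosed.clone _ in_sub_value_group _).

End ValueQuotient.

Section ResidueField.
Variables (L : fieldType) (G : orderedZmodType) (v : valuation L G).

Definition in_valuation_ring : pred L := fun x => Fin 0 <= v x.

Fact valuation_ring_closed : subring_closed in_valuation_ring.
Proof.
split; first by rewrite unfold_in /in_valuation_ring valuation1.
  move=> x y; rewrite !unfold_in /in_valuation_ring => x0 y0.
  by apply: le_trans (valuationD v x (- y)); rewrite valuationN le_min x0.
move=> x y; rewrite !unfold_in /in_valuation_ring valuationM.
exact: vinf_addr_ge0.
Qed.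

HB.instance Definition _ :=
  GRing.isSubringClosed.Build L in_valuation_ring valuation_ring_closed.

Definition valuation_ring := {x : L | in_valuation_ring x}.
HB.instance Definition _ := Choice.on valuation_ring.
HB.instance Definition _ := [isSub of valuation_ring for @sval _ _].
HB.instance Definition _ :=
  [SubChoice_isSubComNzRing of valuation_ring by <:].

Definition in_maximal_ideal : pred valuation_ring := fun x => Fin 0 < v (val x).

Fact maximal_ideal_closed : idealr_closed in_maximal_ideal.
Proof.
split.
- by rewrite unfold_in /in_maximal_ideal rmorph0 valuation0 lt_Infty.
- by rewrite unfold_in /in_maximal_ideal rmorph1 valuation1 ltxx.
- move=> c x y; rewrite !unfold_in /in_maximal_ideal rmorphD rmorphM => x0 y0.
  apply: lt_le_trans (valuationD v _ _); rewrite lt_min y0 andbT valuationM addrC.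
  by apply: vinf_addr_gt0 => //; apply: (valP c).
Qed.

HB.instance Definition _ := isIdealr.Build
  valuation_ring in_maximal_ideal maximal_ideal_closed.

Definition residue_field :=
  Quotient.quot (Idealr.clone _ in_maximal_ideal _).
HB.instance Definition _ := GRing.ComNzRing.on residue_field.

(* The residue of [x], with junk value 0 when [x] is not in the valuation
   ring. *)
Definition residue (x : L) : residue_field :=
  \pi_residue_field%qT (insubd (0 : valuation_ring) x).

Definition residue_inv (r : residue_field) : residue_field :=
  residue (val (repr r))^-1.

Lemma residue_val (x : valuation_ring) : residue (val x) = \pi_residue_field%qT x.
Proof. by rewrite /residue valKd. Qed.

Lemma residue_repr (r : residue_field) : residue (val (repr r)) = r.
Proof. by rewrite residue_val reprK. Qed.

Lemma pi_eq0 (x : valuation_ring) :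
  (\pi_residue_field%qT x == 0) = (Fin 0 < v (val x)).
Proof.
have -> : 0 = \pi_residue_field%qT 0 by rewrite raddf0.
by rewrite -Quotient.idealrBE subr0.
Qed.

Lemma residueE x (vx : in_valuation_ring x) :
  residue x = \pi_residue_field%qT (Sub x vx).
Proof. by rewrite -[x in LHS](SubK valuation_ring vx) residue_val. Qed.

Lemma residue_eq x y : Fin 0 <= v x -> Fin 0 <= v y ->
  residue x = residue y <-> Fin 0 < v (x - y).
Proof.
move=> vx vy; rewrite (residueE vx) (residueE vy).
rewrite -[x in v (x - y)](SubK valuation_ring vx).
rewrite -[y in v (_ - y)](SubK valuation_ring vy) -rmorphB -pi_eq0 rmorphB.
by rewrite subr_eq0; split=> /eqP.
Qed.

Lemma residue1 : residue 1 = 1.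
Proof.
by rewrite -[1 in LHS]/(val (1 : valuation_ring)) residue_val rmorph1.
Qed.

Lemma residueB x y : Fin 0 <= v x -> Fin 0 <= v y ->
  residue (x - y) = residue x - residue y.
Proof.
move=> vx vy; rewrite (residueE vx) (residueE vy).
rewrite -[RHS](rmorphB \pi_residue_field%qT (Sub x vx) (Sub y vy)).
by rewrite -[RHS](residue_val (Sub x vx - Sub y vy)) rmorphB.
Qed.

Lemma residueM x y : Fin 0 <= v x -> Fin 0 <= v y ->
  residue (x * y) = residue x * residue y.
Proof.
move=> vx vy; rewrite (residueE vx) (residueE vy).
rewrite -[RHS](rmorphM \pi_residue_field%qT (Sub x vx) (Sub y vy)).
by rewrite -[RHS](residue_val (Sub x vx * Sub y vy)) rmorphM.
Qed.

Fact residue_mulVf (r : residue_field) : r != 0 -> residue_inv r * r = 1.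
Proof.
move=> r0; set x := repr r; have rE : r = \pi_residue_field%qT x by rewrite reprK.
have vx : v (val x) = Fin 0.
  apply/eqP; rewrite eq_le andbC (valP x : Fin 0 <= v (val x)) /=.
  by move: r0; rewrite rE pi_eq0 leNgt.
have x0 : val x != 0 by apply: (Fin_val_neq0 vx).
have vi : in_valuation_ring (val x)^-1.
  by rewrite /in_valuation_ring (valuationV vx) oppr0.
rewrite /residue_inv -/x -[(val x)^-1](SubK valuation_ring vi) residue_val.
rewrite [X in _ * X]rE -rmorphM -[RHS](rmorph1 \pi_residue_field%qT).
by congr (\pi_residue_field%qT _); apply: val_inj; rewrite /= mulVf.
Qed.

Fact residue_inv0 : residue_inv 0 = 0.
Proof.
rewrite /residue_inv; set x := repr 0.
have : \pi_residue_field%qT x == 0 by rewrite reprK.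
rewrite pi_eq0 => x_gt0; have [x0|x0] := eqVneq (val x) 0.
  rewrite x0 invr0 -[X in residue X]/(val (0 : valuation_ring)).
  by rewrite residue_val rmorph0.
have [g vx] := val_Fin v x0; rewrite /residue /insubd insubF ?rmorph0 //.
apply: contraTF x_gt0; rewrite /in_valuation_ring (valuationV vx) vx.
rewrite lefE ltfE => /(fun i => oz_leD2l _ _ g i); rewrite addr0 subrr => g0.
by apply/negP => /lt_le_trans /(_ g0); rewrite ltxx.
Qed.

HB.instance Definition _ :=
  GRing.ComNzRing_isField.Build residue_field residue_mulVf residue_inv0.

End ResidueField.

Section ResidueMap.
Variables (L M : fieldType) (G : orderedZmodType) (j : {rmorphism L -> M}).
Variables (v : valuation L G) (w : valuation M G).

(* The canonical embedding, which sends the residue of [x] to the residue of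
   [j x] (see [residue_mapE]). *)
Definition residue_map (e : extends j v w) (r : residue_field v) :
  residue_field w := residue w (j (val (repr r))).

Variable e : extends j v w.

Lemma residue_mapE (x : L) :
  Fin 0 <= v x -> residue_map e (residue v x) = residue w (j x).
Proof.
move=> vx; rewrite /residue_map; set y := repr _.
have : residue v (val y) = residue v x by rewrite residue_repr.
have vy : Fin 0 <= v (val y) by apply: (valP y).
have wx : Fin 0 <= w (j x) by rewrite e.
have wy : Fin 0 <= w (j (val y)) by rewrite e.
by move=> /(residue_eq vy vx) yx; apply/(residue_eq wy wx); rewrite -rmorphB e.
Qed.

Fact residue_map_zmod_morphism : zmod_morphism (residue_map e).
Proof.
move=> r s; rewrite -[r]residue_repr -[s]residue_repr.
set x := repr r; set y := repr s.
have [vx vy] : in_valuation_ring v (val x) /\ in_valuation_ring v (val y).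
  by split; apply: valP.
rewrite -residueB // !residue_mapE //; last exact: (valP (x - y)).
by rewrite rmorphB residueB // /in_valuation_ring e.
Qed.

Fact residue_map_monoid_morphism : monoid_morphism (residue_map e).
Proof.
split.
  by rewrite -(residue1 v) residue_mapE ?valuation1 // rmorph1 residue1.
move=> r s; rewrite -[r]residue_repr -[s]residue_repr.
set x := repr r; set y := repr s.
have [vx vy] : in_valuation_ring v (val x) /\ in_valuation_ring v (val y).
  by split; apply: valP.
rewrite -residueM // !residue_mapE //; last exact: (valP (x * y)).
by rewrite rmorphM residueM // /in_valuation_ring e.
Qed.

HB.instance Definition _ := GRing.isZmodMorphism.Build
  (residue_field v) (residue_field w) (residue_map e)
  residue_map_zmod_morphism.
HB.instance Definition _ := GRing.isMonoidMorphism.Build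
  (residue_field v) (residue_field w) (residue_map e)
  residue_map_monoid_morphism.

End ResidueMap.

Section Adjoin.
Variables (F E : fieldType) (i : {rmorphism F -> E}) (a : E).

(* The subfield F(a) of E, as the set of values at a of rational functions. *)
Definition in_adjoin : pred E := fun y =>
  `[< exists p q : {poly F}, (map_poly i q).[a] != 0 /\
        y = (map_poly i p).[a] / (map_poly i q).[a] >].

Fact adjoin_closed : divring_closed in_adjoin.
Proof.
split.
- apply/asboolP; exists 1, 1; rewrite rmorph1 hornerC oner_eq0.
  by split=> //; rewrite divr1.
- move=> _ _ /asboolP[p [q [q0 ->]]] /asboolP[p' [q' [q'0 ->]]].
  apply/asboolP; exists (p * q' - p' * q), (q * q').
  rewrite rmorphB !rmorphM !hornerE mulf_neq0 //; split=> //.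
  by rewrite -mulNr addf_div // mulNr.
- move=> _ _ /asboolP[p [q [q0 ->]]] /asboolP[p' [q' [q'0 ->]]].
  apply/asboolP; have [p'0|p'0] := eqVneq (map_poly i p').[a] 0.
    exists 0, 1; rewrite rmorph0 rmorph1 !hornerE oner_neq0.
    by rewrite p'0 !(mul0r, invr0, mulr0).
  exists (p * q'), (q * p'); rewrite !rmorphM !hornerE mulf_neq0 //.
  by split=> //; rewrite invf_div mulf_div.
Qed.

HB.instance Definition _ :=
  GRing.isDivringClosed.Build E in_adjoin adjoin_closed.

Definition adjoin := {y : E | in_adjoin y}.
HB.instance Definition _ := Choice.on adjoin.
HB.instance Definition _ := [isSub of adjoin for @sval _ _].
HB.instance Definition _ := [SubChoice_isSubIntegralDomain of adjoin by <:].
HB.instance Definition _ := [SubIntegralDomain_isSubField of adjoin by <:].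

Fact in_adjoinC (c : F) : in_adjoin (i c).
Proof.
apply/asboolP; exists c%:P, 1.
by rewrite rmorph1 hornerC oner_neq0 divr1 map_polyC hornerC.
Qed.

Definition adjoin_val : adjoin -> E := val.
HB.instance Definition _ := GRing.RMorphism.on adjoin_val.

Definition adjoinC (c : F) : adjoin := Sub (i c) (in_adjoinC c).

Fact adjoinC_zmod_morphism : zmod_morphism adjoinC.
Proof. by move=> c d; apply: val_inj; rewrite /= rmorphB. Qed.

Fact adjoinC_monoid_morphism : monoid_morphism adjoinC.
Proof.
by split=> [|c d]; apply: val_inj; rewrite /= ?rmorph1 // rmorphM.
Qed.

HB.instance Definition _ :=
  GRing.isZmodMorphism.Build F adjoin adjoinC adjoinC_zmod_morphism.
HB.instance Definition _ :=
  GRing.isMonoidMorphism.Build F adjoin adjoinC adjoinC_monoid_morphism.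

End Adjoin.

Section FieldExtension.
Variables (F E : fieldType) (i : {rmorphism F -> E}).

(* E has an F-basis with n elements. *)
Definition has_degree (n : nat) : Prop :=
  exists e : 'I_n -> E, forall y : E,
    exists! c : 'rV[F]_n, y = \sum_k i (c 0 k) * e k.

(* [E : F], with junk value 0 when E is not finite over F. *)
Definition ext_degree : nat := xget 0%N [set n | has_degree n].

(* trdeg[E : F] = 1: there is a transcendence basis {t}. *)
Definition trdeg_eq1 : Prop :=
  exists t : E, ~ algebraicOver i t /\
    forall u : E, algebraicOver (@adjoin_val F E i t) u.

End FieldExtension.

(* [b] exhibits [V] as the tensor product of [M] and the rationals over the
   integers, with its rational vector space structure. *)
Definition is_tensor_rat (M : zmodType) (V : lmodType rat)
    (b : M -> rat -> V) : Prop :=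
  [/\ forall q, zmod_morphism (b^~ q),
      forall m, zmod_morphism (b m),
      forall m q r, b m (q * r) = q *: b m r &
      forall (W : zmodType) (f : M -> rat -> W),
        (forall q, zmod_morphism (f^~ q)) -> (forall m, zmod_morphism (f m)) ->
        exists2 h : {additive V -> W}, forall m q, h (b m q) = f m q &
          forall h' : {additive V -> W},
            (forall m q, h' (b m q) = f m q) -> h' =1 h].

Section Transcendental.
Variables (L M : fieldType) (G : orderedZmodType) (j : {rmorphism L -> M}).
Variables (v : valuation L G) (w : valuation M G) (e : extends j v w).

Definition value_transcendental : Prop :=
  exists (V : vectType rat) (b : value_quotient w v -> rat -> V),
    is_tensor_rat b /\ \dim {:V} = 1%N.

Definition residue_transcendental : Prop :=
  trdeg_eq1 (residue_map e).

Definition valuation_transcendental : Prop :=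
  value_transcendental \/ residue_transcendental.

End Transcendental.

Notation ratfun K := {fraction {poly K}}.

Definition ratC (K : fieldType) (c : K) : ratfun K := tofrac c%:P.
HB.instance Definition _ (K : fieldType) :=
  GRing.RMorphism.copy (@ratC K) (@tofrac {poly K} \o polyC).

Lemma frac_repr (R : idomainType) (f : {fraction R}) :
  f = tofrac \n_(repr f) / tofrac \d_(repr f).
Proof.
have d0 : tofrac \d_(repr f) != 0 by rewrite tofrac_eq0 denom_ratioP.
apply: (mulIf d0); rewrite divfK // -{1}[f]reprK; set r := repr f.
unlock FracField.tofrac; rewrite -[LHS]FracField.pi_mul; apply/eqmodP.
rewrite /= FracField.equivfE /FracField.mulf.
rewrite !numden_Ratio ?mulf_neq0 ?oner_neq0 ?denom_ratioP //.
by rewrite !mulr1 mulrC.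
Qed.

Section RatMap.
Variables (K F : fieldType) (i : {rmorphism K -> F}).

(* The embedding of K(x) in F(x) that extends i and fixes x. *)
Definition ratmap (f : ratfun K) : ratfun F :=
  tofrac (map_poly i \n_(repr f)) / tofrac (map_poly i \d_(repr f)).

Lemma ratmapE (p q : {poly K}) : q != 0 ->
  ratmap (tofrac p / tofrac q)
  = tofrac (map_poly i p) / tofrac (map_poly i q).
Proof.
move=> q0; rewrite /ratmap; set f := tofrac p / _.
have d0 := denom_ratioP (repr f).
have /eqP : f = tofrac \n_(repr f) / tofrac \d_(repr f) by apply: frac_repr.
rewrite {1}/f eqr_div ?tofrac_eq0 // -!tofracM tofrac_eq => /eqP e.
apply/eqP; rewrite eqr_div ?tofrac_eq0 ?map_poly_eq0 //.
by rewrite -!tofracM -!rmorphM e.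
Qed.

Lemma ratmap_tofrac (p : {poly K}) :
  ratmap (tofrac p) = tofrac (map_poly i p).
Proof.
have := @ratmapE p 1 (oner_neq0 _).
by rewrite !rmorph1 !divr1.
Qed.

Fact ratmap_zmod_morphism : zmod_morphism ratmap.
Proof.
move=> f g; rewrite (frac_repr f) (frac_repr g).
have := denom_ratioP (repr f); have := denom_ratioP (repr g).
move: \n_(repr f) \d_(repr f) \n_(repr g) \d_(repr g) => p q p' q' q'0 q0.
rewrite -mulNr addf_div ?tofrac_eq0 // -tofracN -!tofracM -tofracD.
rewrite !ratmapE ?mulf_neq0 // -mulNr addf_div ?tofrac_eq0 ?map_poly_eq0 //.
by rewrite -tofracN -!tofracM -tofracD rmorphD !rmorphM rmorphN.
Qed.

Fact ratmap_monoid_morphism : monoid_morphism ratmap.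
Proof.
split; first by rewrite -tofrac1 ratmap_tofrac rmorph1.
move=> f g; rewrite (frac_repr f) (frac_repr g).
have := denom_ratioP (repr f); have := denom_ratioP (repr g).
move: \n_(repr f) \d_(repr f) \n_(repr g) \d_(repr g) => p q p' q' q'0 q0.
rewrite mulf_div -!tofracM !ratmapE ?mulf_neq0 // mulf_div -!tofracM.
by rewrite !rmorphM.
Qed.

HB.instance Definition _ := GRing.isZmodMorphism.Build
  (ratfun K) (ratfun F) ratmap ratmap_zmod_morphism.
HB.instance Definition _ := GRing.isMonoidMorphism.Build
  (ratfun K) (ratfun F) ratmap ratmap_monoid_morphism.

End RatMap.

Section PairOfDefinition.
Variables (G : orderedZmodType) (F : fieldType) (w : valuation (ratfun F) G).

(* [w] is the valuation of F(x) built from its restriction to F, the center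
   [a] and the value [g]; polynomials are given by their expansion at [a]. *)
Definition is_monomial_valuation (a : F) (g : G) : Prop :=
  forall n (c : 'I_n -> F),
    w (tofrac (\sum_(k < n) c k *: ('X - a%:P) ^+ k)) =
    \big[Order.min/Infty]_(k < n) (restr (@ratC F) w (c k) + Fin (g *+ k)).

Definition pair_of_definition (a : F) (g : G) : Prop :=
  g \in in_value_group w /\ is_monomial_valuation a g.

Definition minimal_pair_of_definition (K : fieldType) (i : {rmorphism K -> F})
    (a : F) (g : G) : Prop :=
  pair_of_definition a g /\
  forall b : F, Fin g <= restr (@ratC F) w (a - b) ->
    (ext_degree (adjoinC i a) <= ext_degree (adjoinC i b))%N.

End PairOfDefinition.

Section ValuedSubfield.
Variables (G : orderedZmodType) (K F : fieldType) (i : {rmorphism K -> F}).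
Variables (w : valuation (ratfun F) G) (a : F).

Definition adjoin_rat : adjoin i a -> ratfun F := @ratC F \o @adjoin_val K F i a.
HB.instance Definition _ := GRing.RMorphism.copy adjoin_rat
  (@ratC F \o @adjoin_val K F i a).

Definition adjoin_valuation : valuation (adjoin i a) G := restr adjoin_rat w.

(* The residue field of K(a), as a subset of the residue field of w. *)
Definition adjoin_residue_field : set (residue_field w) :=
  range (residue_map (extends_restr adjoin_rat w)).

End ValuedSubfield.

Arguments adjoin_residue_field {G K F} i w a.

(* Main.v *)
(* Let d = [K(a) : K].  If h in K[x] has degree < d, minimality gives
   nu(a - b) < gamma for every root b of h, so h(x)/h(a) has residue 1.  As every
   element of K(a) is such an h(a), the value group and the residue field of
   K(a) consist of the values and residues of the h(x) with deg h < d: they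
   depend only on omega and d.
   It remains to see that d depends only on omega and gamma.  It is the least
   degree of a polynomial f over K having a root b with omegab(x - b) = gamma,
   the largest possible value.  The number of such roots is read off the Newton
   polygon of the polynomial f(x + t) in t, whose roots are the b - x and whose
   coefficients lie in K(x). *)
Require Import Defs.
From mathcomp Require Import all_boot all_order all_algebra.
From mathcomp Require Import boolp classical_sets functions cardinality.

Set Implicit Arguments.
Unset Strict Implicit.
Unset Printing Implicit Defensive.

Local Open Scope classical_set_scope.
Local Open Scope card_scope.
Local Open Scope ring_scope.

Import Order.TTheory GRing.Theory.

(** * Values, one-units, and Gauss reduction of products of linear factors *)

Section ValuationLemmas.
Variables (G : orderedZmodType) (L : fieldType) (v : valuation L G).

Lemma vinf_lerDr (g : G) (u t : vinf G) : (u + Fin g <= t + Fin g) = (u <= t).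
Proof.
case: u t => [h|] [k|] //; rewrite !FinD !lefE ![_ + g]addrC.
apply/idP/idP => [/(fun p => oz_leD2l _ _ (- g) p)|]; last exact: oz_leD2l.
by rewrite !addKr.
Qed.

Lemma vinf_ltrDr (g : G) (u t : vinf G) : (u + Fin g < t + Fin g) = (u < t).
Proof. by rewrite !ltNge vinf_lerDr. Qed.

Lemma vinf_addIr (g : G) : injective (fun u : vinf G => u + Fin g).
Proof.
move=> u t /= e; apply/le_anti.
by rewrite -(vinf_lerDr g u) -(vinf_lerDr g t) e lexx.
Qed.

Lemma Fin_mulrn (g : G) n : Fin g *+ n = Fin (g *+ n).
Proof. by elim: n => // n IHn; rewrite !mulrS IHn. Qed.

Lemma valuationX x n : v (x ^+ n) = v x *+ n.
Proof.
elim: n => [|n IHn]; first by rewrite expr0 valuation1.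
by rewrite exprS mulrS valuationM IHn.
Qed.

Lemma valuation_div x y g : v y = Fin g -> v (x / y) + Fin g = v x.
Proof. by move=> vy; rewrite -vy -valuationM divfK // (Fin_val_neq0 vy). Qed.

Lemma valuation_div_ge0 x y : y != 0 -> (Fin 0 <= v (x / y)) = (v y <= v x).
Proof.
move=> y0; have [h vy] := val_Fin v y0.
by rewrite -(valuation_div x vy) -(vinf_lerDr h) FinD add0r vy.
Qed.

Lemma valuation_div_gt0 x y : y != 0 -> (Fin 0 < v (x / y)) = (v y < v x).
Proof.
move=> y0; have [h vy] := val_Fin v y0.
by rewrite -(valuation_div x vy) -(vinf_ltrDr h) FinD add0r vy.
Qed.

Lemma valuationD_gt u x y : u < v x -> u < v y -> u < v (x + y).
Proof.
by move=> ux uy; apply: lt_le_trans (valuationD v x y); rewrite lt_min ux.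
Qed.

Lemma valuationD_ge u x y : u <= v x -> u <= v y -> u <= v (x + y).
Proof.
by move=> ux uy; apply: le_trans (valuationD v x y); rewrite le_min ux.
Qed.

Lemma valuationD_eqr x y : v x < v y -> v (x + y) = v x.
Proof.
move=> xy; apply/eqP; rewrite eq_le valuationD_ge // ?(ltW xy) // andbT leNgt.
apply/negP => xxy; have : v x < v (x + y - y).
  by apply: valuationD_gt; rewrite ?valuationN.
by rewrite addrK ltxx.
Qed.

Lemma valuationM_gt0 x y : Fin 0 < v x -> Fin 0 <= v y -> Fin 0 < v (x * y).
Proof. by rewrite valuationM; apply: vinf_addr_gt0. Qed.

Lemma one_unit_valuation x : Fin 0 < v (x - 1) -> v x = Fin 0.
Proof.
by move=> x1; rewrite -[x](subrK 1) addrC valuationD_eqr valuation1.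
Qed.

Lemma one_unitM x y :
  Fin 0 < v (x - 1) -> Fin 0 < v (y - 1) -> Fin 0 < v (x * y - 1).
Proof.
move=> x1 y1; have -> : x * y - 1 = (x - 1) * y + (y - 1).
  by rewrite mulrBl mul1r addrA subrK.
by apply: valuationD_gt => //; apply: valuationM_gt0; rewrite // one_unit_valuation.
Qed.

(** As [x - y] equals [y] times [x / y - 1], closeness of the quotient to 1 becomes equality of
    values and, for values at least 0, of residues. *)
Lemma one_unit_div x y : y != 0 -> Fin 0 < v (x / y - 1) ->
  v x = v y /\ v x < v (x - y).
Proof.
move=> y0 xy; have [h vy] := val_Fin v y0.
have vxy : v x = v y.
  by rewrite -(valuation_div x vy) (one_unit_valuation xy) FinD add0r vy.
split=> //; rewrite vxy -valuation_div_gt0 //.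
by rewrite mulrBl divff.
Qed.

(** Factors are normalized to constant term 1, so a nonzero [c] is minus the reciprocal of a
    root. *)
Definition gauss_poly (s : seq L) : {poly L} := \prod_(c <- s) (1 + c *: 'X).

Lemma coef_gauss_cons c s k : (gauss_poly (c :: s))`_k =
  (gauss_poly s)`_k + (if k is k'.+1 then c * (gauss_poly s)`_k' else 0).
Proof.
rewrite /gauss_poly big_cons mulrDl mul1r coefD -scalerAl coefZ coefXM.
by case: k => [|k]; rewrite ?mulr0.
Qed.

(** Scaling every [c] by [t] substitutes [t X] for [X]; this brings the slope of interest to 0. *)
Lemma coef_gauss_scale t s k :
  (gauss_poly [seq t * c | c <- s])`_k = t ^+ k * (gauss_poly s)`_k.
Proof.
elim: s k => [|c s IHs] k.
  by rewrite /gauss_poly /= !big_nil coef1; case: k => [|k]; rewrite ?mulr1 ?mulr0.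
rewrite /= !coef_gauss_cons mulrDr IHs; case: k => [|k]; rewrite ?mulr0 //.
by rewrite IHs exprS mulrACA.
Qed.

(* Reduction of [gauss_poly s] modulo the maximal ideal kills exactly the
   factors whose [c] has positive value. *)
Lemma gauss_degree s (m := count (fun c => v c == Fin 0) s) :
  (forall c, c \in s -> Fin 0 <= v c) ->
  [/\ forall k, Fin 0 <= v (gauss_poly s)`_k,
      v (gauss_poly s)`_m = Fin 0 &
      forall k, (m < k)%N -> Fin 0 < v (gauss_poly s)`_k].
Proof.
rewrite {}/m; elim: s => [|c s IHs] s_ge0.
  split=> [k||[|k] //]; rewrite /gauss_poly big_nil ?coef1 /= ?valuation1 //.
  - by case: k => [|k]; rewrite ?valuation1 ?valuation0 ?le_Infty.
  - by rewrite valuation0 lt_Infty.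
have c0 : Fin 0 <= v c by apply: s_ge0; rewrite inE eqxx.
have {}IHs := IHs (fun x xs => s_ge0 x (mem_behead (s := c :: s) xs)).
rewrite /=; move: (count _ s) IHs => m [p_ge0 p_m p_gt].
have cp_ge0 k : Fin 0 <= v (if k is k'.+1 then c * (gauss_poly s)`_k' else 0).
  case: k => [|k]; first by rewrite valuation0 le_Infty.
  by rewrite valuationM vinf_addr_ge0.
split=> [k||k]; first by rewrite coef_gauss_cons valuationD_ge.
  (* If [v c] is 0, the last coefficient of value 0 moves to index m + 1: there [c] times the old
     coefficient at m dominates the old one at m + 1. *)
  rewrite coef_gauss_cons; case: eqP => [vc|/eqP vc].
    rewrite add1n addrC valuationD_eqr valuationM vc p_m add0r // p_gt //.
  rewrite add0n valuationD_eqr p_m //.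
  case: m {p_m p_gt} => [|m]; first by rewrite valuation0 lt_Infty.
  by apply: valuationM_gt0; rewrite // lt_neqAle eq_sym vc.
rewrite coef_gauss_cons; case: eqP => [vc|/eqP vc].
  case: k => // k; rewrite add1n ltnS => mk.
  rewrite valuationD_gt ?p_gt ?(leq_trans mk) // ?leqW //.
  by rewrite mulrC valuationM_gt0 ?p_gt.
rewrite add0n => mk; rewrite valuationD_gt ?p_gt //.
case: k {mk} => [|k]; first by rewrite valuation0 lt_Infty.
by apply: valuationM_gt0; rewrite // lt_neqAle eq_sym vc.
Qed.

End ValuationLemmas.

(** * Uniqueness of the degree of a field extension *)

Section Degree.
Variables (F E : fieldType) (i : {rmorphism F -> E}).

(** Writing each basis in the other gives matrices A, B with AB = 1 of size n, which cannot factor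
    through fewer than n coordinates. *)
Lemma has_degree_leq n m : has_degree i n -> has_degree i m -> (n <= m)%N.
Proof.
move=> [e eP] [e' e'P].
have [A AP] : exists A : 'M[F]_(n, m),
    forall k, e k = \sum_l i (A k l) * e' l.
  have /choice[f fP] k : exists c : 'rV[F]_m, e k = \sum_l i (c 0 l) * e' l.
    by have [c [cP _]] := e'P (e k); exists c.
  exists (\matrix_(k, l) f k 0 l) => k; rewrite {1}fP.
  by under [RHS]eq_bigr do rewrite mxE.
have [B BP] : exists B : 'M[F]_(m, n),
    forall k, e' k = \sum_l i (B k l) * e l.
  have /choice[f fP] k : exists c : 'rV[F]_n, e' k = \sum_l i (c 0 l) * e l.
    by have [c [cP _]] := eP (e' k); exists c.
  exists (\matrix_(k, l) f k 0 l) => k; rewrite {1}fP.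
  by under [RHS]eq_bigr do rewrite mxE.
apply: (@mulmx1_min _ _ _ A B); apply/row_matrixP => k.
(* Row k of 1 and row k of AB are both coordinates of [e k], hence equal. *)
have [c [_ c_uniq]] := eP (e k); rewrite -[LHS]c_uniq -?[RHS]c_uniq //.
  rewrite (bigD1 k) //= !mxE eqxx rmorph1 mul1r big1 ?addr0 // => l lk.
  by rewrite !mxE eq_sym (negPf lk) rmorph0 mul0r.
under eq_bigr do rewrite !mxE rmorph_sum mulr_suml.
rewrite exchange_big AP; apply: eq_bigr => l _; rewrite BP mulr_sumr.
by apply: eq_bigr => l' _; rewrite rmorphM mulrA.
Qed.

Lemma has_degreeE n : has_degree i n -> ext_degree i = n.
Proof.
move=> hn; rewrite /ext_degree; case: xgetP => [m _ hm|/(_ n)] //.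
by apply/eqP; rewrite eqn_leq !has_degree_leq.
Qed.

End Degree.

(** * Minimal polynomials and the degree of a simple extension *)

Section MinimalPolynomial.
Variables (F E : fieldType) (i : {rmorphism F -> E}) (a : E).
Local Notation "p ^i" := (map_poly i p) (at level 2, format "p ^i").

(** Not normalized to be monic: only its degree and its vanishing at [a] matter. *)
Definition is_minimal_poly (f : {poly F}) : Prop :=
  [/\ f != 0, root f^i a &
      forall g, g != 0 -> root g^i a -> (size f <= size g)%N].

Lemma minimal_poly_exists : algebraicOver i a -> exists f, is_minimal_poly f.
Proof.
move=> [f f0 fa].
have [|n /asboolP[g [g0 ga gn]] n_min] :=
    @ex_minnP (fun n => `[< exists g, [/\ g != 0, root g^i a & size g = n] >]).
  by exists (size f); apply/asboolP; exists f.
exists g; split=> // h h0 ha; rewrite gn; apply: n_min.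
by apply/asboolP; exists h.
Qed.

Variables (f : {poly F}) (f_min : is_minimal_poly f).

Lemma minimal_poly_eq0 (g : {poly F}) : (size g < size f)%N -> root g^i a -> g = 0.
Proof.
move=> gf ga; apply/eqP; apply: contraTT gf => g0; rewrite -leqNgt.
by have [_ _] := f_min; apply.
Qed.

Lemma horner_modp (g : {poly F}) : (g %% f)^i.[a] = g^i.[a].
Proof.
have [_ /rootP fa _] := f_min.
by rewrite {2}(divp_eq g f) rmorphD rmorphM !hornerE fa mulr0 add0r.
Qed.

Lemma size_modp_minimal (g : {poly F}) : (size (g %% f)%R < size f)%N.
Proof. by have [f0 _ _] := f_min; rewrite ltn_modp. Qed.

(** As q(a) is nonzero, q is coprime to f; a Bezout relation turns 1/q(a) into a polynomial in a,
    and reduction modulo f bounds the degree. *)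
Lemma in_adjoinP y :
  in_adjoin i a y -> exists2 g : {poly F}, (size g < size f)%N & y = g^i.[a].
Proof.
move=> /asboolP[p [q [qa ->]]]; have [f0 /rootP fa f_le] := f_min.
have /Bezout_eq1_coprimepP[[u v] /= uv] : coprimep f q.
  rewrite /coprimep; set d := gcdp f q.
  have /dvdpP[h fE] : d %| f by apply: dvdp_gcdl.
  have /dvdpP[h' qE] : d %| q by apply: dvdp_gcdr.
  have d0 : d != 0 by rewrite gcdp_eq0 (negPf f0).
  have h0 : h != 0 by apply: contraNneq f0 => h0; rewrite fE h0 mul0r.
  have /(f_le h h0) : root h^i a.
    move: fa; rewrite fE rmorphM hornerM => /eqP; rewrite mulf_eq0 => /orP[//|].
    by move=> da; move: qa; rewrite qE rmorphM hornerM (eqP da) mulr0 eqxx.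
  (* From size f = size h + size d - 1 and size f <= size h it follows that d is constant. *)
  rewrite {1}fE size_mul // -subn1 leq_subLR add1n.
  rewrite addnC -ltnS -addSn => le; rewrite eqn_leq lt0n size_poly_eq0 d0 andbT.
  by rewrite -(leq_add2r (size h)) add1n.
have va : v^i.[a] = (q^i.[a])^-1.
  apply: (mulIf qa); rewrite mulVf // -hornerM -rmorphM.
  have := congr1 (fun g => g^i.[a]) uv.
  by rewrite rmorphD !rmorphM !hornerE fa mulr0 add0r rmorph1 hornerE.
exists ((p * v) %% f); first exact: size_modp_minimal.
by rewrite horner_modp rmorphM hornerM va.
Qed.

Lemma horner_in_adjoin (g : {poly F}) : in_adjoin i a g^i.[a].
Proof.
by apply/asboolP; exists g, 1; rewrite rmorph1 hornerE oner_eq0 divr1.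
Qed.

(** The powers of a below the degree of f form a basis: they span by [in_adjoinP], and minimality of
    f gives uniqueness. *)
Lemma ext_degree_minimal_poly : ext_degree (adjoinC i a) = (size f).-1.
Proof.
have [f0 _ _] := f_min; set n := (size f).-1.
have sf : size f = n.+1 by rewrite prednK // lt0n size_poly_eq0.
have horner_row (c : 'rV[F]_n) :
    (rVpoly c)^i.[a] = \sum_(k < n) i (c 0 k) * a ^+ k.
  rewrite (@horner_coef_wide _ n); last by rewrite size_map_poly size_poly.
  by apply: eq_bigr => k _; rewrite coef_map coef_rVpoly_ord.
have in_powers k : in_adjoin i a (a ^+ k).
  by have := horner_in_adjoin 'X^k; rewrite map_polyXn hornerXn.
apply: has_degreeE; exists (fun k : 'I_n => Sub (a ^+ k) (in_powers k)) => y.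
have [g gf yE] := in_adjoinP (valP y).
have yP (c : 'rV[F]_n) :
    (y = \sum_k adjoinC i a (c 0 k) * Sub (a ^+ k) (in_powers k)) <->
    g = rVpoly c.
  have gP : g = rVpoly c <-> g^i.[a] = (rVpoly c)^i.[a].
    split=> [->//|gc]; apply/eqP; rewrite -subr_eq0; apply/eqP.
    apply: minimal_poly_eq0; last by rewrite rmorphB rootE !hornerE gc subrr.
    rewrite sf ltnS (leq_trans (size_polyD _ _)) // size_polyN geq_max size_poly.
    by rewrite -ltnS -sf gf.
  rewrite gP -yE horner_row; split=> [->|ye]; first by rewrite rmorph_sum.
  by apply: val_inj; rewrite ye rmorph_sum.
exists (poly_rV g); split=> [|c /yP ->]; last by rewrite rVpolyK.
by apply/yP; rewrite poly_rV_K // -ltnS -sf.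
Qed.

End MinimalPolynomial.

(** * Linear factors under a monomial valuation *)

Section Contact.
Variables (G : orderedZmodType) (F : fieldType) (w : valuation (ratfun F) G).
Variables (a : F) (g : G).
Hypothesis w_monomial : is_monomial_valuation w a g.

Lemma tofrac_linear_split b :
  tofrac ('X - b%:P) = tofrac ('X - a%:P) + ratC (a - b).
Proof. by rewrite /ratC -tofracD polyCB addrA subrK. Qed.

Lemma monomial_linear b :
  w (tofrac ('X - b%:P)) = Order.min (w (ratC (a - b))) (Fin g).
Proof.
(* The expansion of x - b at a is (a - b) + (x - a). *)
have := w_monomial (fun k : 'I_2 => if k == ord0 then a - b else 1).
rewrite !big_ord_recl !big_ord0 /= expr0 expr1 scale1r alg_polyC addr0.
rewrite addrC polyCB addrA subrK => ->.
by rewrite addr0 rmorph1 valuation1 add0r (min_idPl (le_Infty _)).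
Qed.

Lemma monomial_center : w (tofrac ('X - a%:P)) = Fin g.
Proof.
by rewrite monomial_linear subrr rmorph0 valuation0 (min_idPr (le_Infty _)).
Qed.

(** Subtracting 1 leaves (x - a)/(a - b), whose numerator has value g. *)
Lemma linear_one_unit b : w (ratC (a - b)) < Fin g ->
  Fin 0 < w (tofrac ('X - b%:P) / ratC (a - b) - 1).
Proof.
move=> ab; have ab0 : ratC (a - b) != 0.
  by apply: contraTneq ab => ->; rewrite valuation0 -leNgt le_Infty.
rewrite tofrac_linear_split mulrDl divff // addrK valuation_div_gt0 //.
by rewrite monomial_center.
Qed.

Lemma prod_linear_one_unit r : (forall b, b \in r -> w (ratC (a - b)) < Fin g) ->
  let p := \prod_(b <- r) ('X - b%:P) in
  p.[a] != 0 /\ Fin 0 < w (tofrac p / ratC p.[a] - 1).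
Proof.
elim: r => [|b r IHr] r_lt /=.
  rewrite big_nil hornerE oner_neq0; split=> //.
  by rewrite !rmorph1 divr1 subrr valuation0 lt_Infty.
have /= [p0 pu] := IHr (fun x xr => r_lt x (mem_behead (s := b :: r) xr)).
have br : w (ratC (a - b)) < Fin g by apply: r_lt; rewrite inE eqxx.
have ab : a - b != 0.
  by apply: contraTneq br => ->; rewrite rmorph0 valuation0 -leNgt le_Infty.
rewrite big_cons hornerM hornerXsubC mulf_neq0 //; split=> //.
rewrite !rmorphM /= -mulf_div; apply: one_unitM => //; exact: linear_one_unit.
Qed.

End Contact.

(** * Taylor expansion at x *)

Section Taylor.
Variable K : fieldType.

(* The expansion of p(x + t) in powers of t. *)
Definition taylor (p : {poly K}) : {poly ratfun K} :=
  map_poly (@ratC K) p \Po ('X + (tofrac 'X)%:P).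

Lemma taylorM p q : taylor (p * q) = taylor p * taylor q.
Proof. by rewrite /taylor (rmorphM (map_poly (@ratC K))) comp_polyM. Qed.

Lemma taylorC c : taylor c%:P = (ratC c)%:P.
Proof. by rewrite /taylor map_polyC comp_polyC. Qed.

Lemma taylor_linear b :
  taylor ('X - b%:P) =
  tofrac ('X - b%:P) *: (1 + (tofrac ('X - b%:P))^-1 *: 'X).
Proof.
rewrite scalerDr scalerA divff ?tofrac_eq0 ?polyXsubC_eq0 // scale1r alg_polyC.
rewrite /taylor (rmorphB (map_poly (@ratC K))) /= map_polyX map_polyC.
rewrite comp_polyB comp_polyX comp_polyC [RHS]addrC -addrA; congr (_ + _).
by rewrite tofracB polyCB.
Qed.

(** Each x - b becomes t + (x - b). Extracting x - b from every factor puts p(x) in front and leaves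
    the factors 1 + t/(x - b). *)
Lemma taylor_prod_linear c r (p := c *: \prod_(b <- r) ('X - b%:P)) :
  taylor p = tofrac p *: gauss_poly [seq (tofrac ('X - b%:P))^-1 | b <- r].
Proof.
rewrite {}/p -mul_polyC taylorM taylorC tofracM -scalerA -mul_polyC.
congr (_ * _); elim: r => [|b r IHr].
  by rewrite /gauss_poly !big_nil tofrac1 scale1r -[1]/1%:P taylorC rmorph1.
rewrite big_cons taylorM IHr taylor_linear /gauss_poly /= big_cons tofracM.
by rewrite -scalerAl -scalerAr scalerA.
Qed.

End Taylor.

(** For f over K the coefficients of f(x + t) lie in K(x), so every extension of omega gives them
    the same values, even though f is factored over F. *)
Lemma map_taylor (K F : fieldType) (i : {rmorphism K -> F}) (p : {poly K}) :
  map_poly (ratmap i) (taylor p) = taylor (map_poly i p).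
Proof.
rewrite /taylor map_comp_poly rmorphD /= map_polyX map_polyC /=.
rewrite ratmap_tofrac map_polyX.
congr (_ \Po _); rewrite -!map_poly_comp; apply: eq_map_poly => c /=.
by rewrite /ratC ratmap_tofrac map_polyC.
Qed.

(** All groups lie in [G] and the same subgroup is divided out, so an inclusion of value groups
    induces an injection of quotients. *)
Lemma card_value_quotient_le (G : orderedZmodType) (L M M' : fieldType)
    (v : valuation L G) (w : valuation M G) (w' : valuation M' G) :
  {subset in_value_group w <= in_value_group w'} ->
  [set: value_quotient w v] #<= [set: value_quotient w' v].
Proof.
move=> ww'.
pose t (g : value_group w) : value_group w' := Sub (val g) (ww' _ (valP g)).
pose f (q : value_quotient w v) := \pi_(value_quotient w' v)%qT (t (repr q)).
have f_inj : {in [set: value_quotient w v] &, injective f}.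
  move=> q r _ _ /eqP; rewrite -Quotient.idealrBE => qr.
  by rewrite -[q]reprK -[r]reprK; apply/eqP; rewrite -Quotient.idealrBE.
rewrite -(card_le_eql (inj_card_eq f_inj)); exact: subset_card_le.
Qed.

(** * Roots in contact with the center, read off the Newton polygon *)

Section RootContact.
Variables (G : orderedZmodType) (K : fieldType) (F : closedFieldType).
Variables (i : {rmorphism K -> F}) (omega : valuation (ratfun K) G).
Local Notation "p ^i" := (map_poly i p) (at level 2, format "p ^i").

Section OneExtension.
Variables (w : valuation (ratfun F) G) (a : F) (g : G).
Hypotheses (w_ext : extends (ratmap i) omega w).
Hypothesis w_monomial : is_monomial_valuation w a g.

(** Here [q] is f(x + t)/f(x) with t replaced by (x - a)t, and [m] counts with multiplicity the
    roots b with w(a - b) >= g. The first clause expresses the values of the coefficients through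
    omega, f and g alone. *)
Lemma contact_polygon (f : {poly K}) : f != 0 ->
  exists q : {poly ratfun F}, exists m : nat,
  [/\ forall k, w q`_k + omega (tofrac f) = omega (taylor f)`_k + Fin (g *+ k),
      w q`_m = Fin 0, forall k, (m < k)%N -> Fin 0 < w q`_k &
      (0 < m)%N <-> exists2 b, root f^i b & Fin g <= w (ratC (a - b))].
Proof.
move=> f0; have [r fE] := closed_field_poly_normal f^i.
pose lin b : ratfun F := tofrac ('X - b%:P).
have lin0 b : lin b != 0 by rewrite tofrac_eq0 polyXsubC_eq0.
(* The elements (x - a)/(x - b) have value g - min(w(a - b), g): never negative, and 0 exactly when
   w(a - b) >= g. *)
pose s := [seq lin a * c | c <- [seq (lin b)^-1 | b <- r]].
have s_ge0 c : c \in s -> Fin 0 <= w c.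
  rewrite /s -map_comp => /mapP[b br ->] /=.
  rewrite valuation_div_ge0 // (monomial_center w_monomial).
  by rewrite (monomial_linear w_monomial) ge_min lexx orbT.
have [_ qm q_gt] := gauss_degree s_ge0.
exists (gauss_poly s), (count (fun c => w c == Fin 0) s); split=> // [k|].
  rewrite coef_gauss_scale valuationM valuationX (monomial_center w_monomial).
  rewrite Fin_mulrn -!w_ext -coef_map map_taylor /= ratmap_tofrac fE.
  rewrite taylor_prod_linear coefZ -fE valuationM -addrA addrC.
  by rewrite [w _ + w _]addrC.
rewrite -has_count; have lc0 : lead_coef f^i != 0.
  by rewrite lead_coef_eq0 map_poly_eq0.
have contact b : (w (lin a / lin b) == Fin 0) = (Fin g <= w (ratC (a - b))).
  rewrite eq_le valuation_div_ge0 // (leNgt (w _)) valuation_div_gt0 // -leNgt.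
  rewrite (monomial_center w_monomial) (monomial_linear w_monomial).
  by rewrite le_min ge_min lexx orbT !andbT.
split=> [/hasP[c]|[b rb gb]].
  rewrite /s -map_comp => /mapP[b br ->] /=; rewrite contact => gb.
  by exists b; rewrite // fE rootZ // root_prod_XsubC.
apply/hasP; exists (lin a / lin b); last by rewrite contact.
rewrite /s -map_comp; apply/mapP; exists b => //.
by move: rb; rewrite fE rootZ // root_prod_XsubC.
Qed.

(** The leading coefficient cancels in h(x)/h(a), leaving a product of one-units (x - b)/(a - b)
    over the roots b. *)
Lemma small_degree_one_unit (h : {poly F}) : h != 0 ->
  (forall b, root h b -> w (ratC (a - b)) < Fin g) ->
  ratC h.[a] != 0 /\ Fin 0 < w (tofrac h / ratC h.[a] - 1).
Proof.
move=> h0 h_lt; have [r hE] := closed_field_poly_normal h.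
have lc0 : lead_coef h != 0 by rewrite lead_coef_eq0.
have [|/= ra0 ru] := @prod_linear_one_unit _ _ _ _ _ w_monomial r.
  by move=> b br; apply: h_lt; rewrite hE rootZ // root_prod_XsubC.
rewrite hE hornerZ rmorphM; split; first by rewrite mulf_neq0 ?fmorph_eq0.
rewrite -mul_polyC tofracM /= -/(ratC _) -mulf_div divff ?mul1r //.
by rewrite fmorph_eq0.
Qed.

End OneExtension.

(** Coefficient values agree for both extensions. If [m] were positive and [m'] zero, the
    coefficient at [m] would have both value 0 and positive value. *)
Lemma contact_transfer (w w' : valuation (ratfun F) G) (a a' : F) (g : G)
    (f : {poly K}) :
  extends (ratmap i) omega w -> extends (ratmap i) omega w' ->
  is_monomial_valuation w a g -> is_monomial_valuation w' a' g ->
  f != 0 -> (exists2 b, root f^i b & Fin g <= w (ratC (a - b))) ->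
  exists2 b, root f^i b & Fin g <= w' (ratC (a' - b)).
Proof.
move=> w_ext w'_ext w_mon w'_mon f0 bP.
have [q [m [qE qm q_gt mP]]] := contact_polygon w_ext w_mon f0.
have [q' [m' [q'E q'm q'_gt m'P]]] := contact_polygon w'_ext w'_mon f0.
apply/m'P; apply/contraT; rewrite -eqn0Ngt => /eqP m'0.
have := q'_gt m; rewrite m'0 => /(_ (mP.2 bP)).
(* The value of f(x) is finite, so it cancels from the two formulas for the coefficient values. *)
have [h fh] : exists h, omega (tofrac f) = Fin h.
  by apply: val_Fin; rewrite tofrac_eq0.
have -> : w' q'`_m = w q`_m.
  by apply: (@vinf_addIr _ h); rewrite /= -fh qE q'E.
by rewrite qm ltxx.
Qed.

End RootContact.

(** * Value group and residue field of K(a) for a minimal pair *)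

Section MinimalPair.
Variables (G : orderedZmodType) (K : fieldType) (F : closedFieldType).
Variables (i : {rmorphism K -> F}) (F_algebraic : forall z : F, algebraicOver i z).
Variables (omega : valuation (ratfun K) G) (g : G).
Local Notation "p ^i" := (map_poly i p) (at level 2, format "p ^i").
Local Notation deg b := (ext_degree (adjoinC i b)).

Lemma ext_degree_root (f : {poly K}) b :
  f != 0 -> root f^i b -> (deg b < size f)%N.
Proof.
move=> f0 fb; have [h h_min] := minimal_poly_exists (F_algebraic b).
rewrite (ext_degree_minimal_poly h_min); have [h0 _ h_le] := h_min.
by rewrite prednK ?h_le // lt0n size_poly_eq0.
Qed.

(** The minimal polynomial of a has the root a itself in contact with a. By transfer it has a root b
    in contact with a', whence deg a' <= deg b <= deg a. *)
Lemma minimal_pair_degree_le (w w' : valuation (ratfun F) G) (a a' : F) :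
  extends (ratmap i) omega w -> extends (ratmap i) omega w' ->
  is_monomial_valuation w a g -> minimal_pair_of_definition w' i a' g ->
  (deg a' <= deg a)%N.
Proof.
move=> w_ext w'_ext w_mon [[_ w'_mon] a'_min].
have [f f_min] := minimal_poly_exists (F_algebraic a); have [f0 fa _] := f_min.
have [|b fb gb] := contact_transfer w_ext w'_ext w_mon w'_mon f0.
  by exists a; rewrite // subrr rmorph0 valuation0 le_Infty.
apply: leq_trans (a'_min b gb) _; rewrite (ext_degree_minimal_poly f_min) -ltnS.
by rewrite prednK ?ext_degree_root // lt0n size_poly_eq0.
Qed.

Variables (w : valuation (ratfun F) G) (a : F).
Hypotheses (w_ext : extends (ratmap i) omega w).
Hypothesis a_min : minimal_pair_of_definition w i a g.

(** The bound [size h <= deg a] means that h has degree below deg a. So do its roots over K, and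
    minimality keeps them out of contact with a. *)
Lemma minimal_pair_one_unit (h : {poly K}) : h != 0 -> (size h <= deg a)%N ->
  ratC h^i.[a] != 0 /\ Fin 0 < w (tofrac h^i / ratC h^i.[a] - 1).
Proof.
move=> h0 ha; have [[_ w_mon] ab_min] := a_min.
apply: (small_degree_one_unit w_mon); rewrite ?map_poly_eq0 // => b hb.
rewrite ltNge; apply/negP => /ab_min; rewrite leqNgt => /negP[].
exact: leq_trans (ext_degree_root h0 hb) ha.
Qed.

Lemma valuation_horner_center (h : {poly K}) : (size h <= deg a)%N ->
  w (ratC h^i.[a]) = omega (tofrac h).
Proof.
move=> ha; have [->|h0] := eqVneq h 0.
  by rewrite rmorph0 horner0 !rmorph0 !valuation0.
have [ha0 hu] := minimal_pair_one_unit h0 ha.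
by rewrite -w_ext /= ratmap_tofrac; have [-> _] := one_unit_div ha0 hu.
Qed.

Lemma residue_horner_center (h : {poly K}) : (size h <= deg a)%N ->
  Fin 0 <= omega (tofrac h) ->
  residue_map w_ext (residue omega (tofrac h)) = residue w (ratC h^i.[a]).
Proof.
move=> ha h_ge0; rewrite residue_mapE //= ratmap_tofrac.
have [->|h0] := eqVneq h 0; first by rewrite !rmorph0 horner0 !rmorph0.
have [ha0 hu] := minimal_pair_one_unit h0 ha.
have wh : w (tofrac h^i) = omega (tofrac h) by rewrite -w_ext /= ratmap_tofrac.
apply/(residue_eq (v := w)); rewrite ?wh ?valuation_horner_center //.
by have [_] := one_unit_div ha0 hu; rewrite wh; apply: le_lt_trans.
Qed.

Lemma adjoin_horner (y : adjoin i a) :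
  exists2 h : {poly K}, (size h <= deg a)%N & val y = h^i.[a].
Proof.
have [f f_min] := minimal_poly_exists (F_algebraic a); have [f0 _ _] := f_min.
have [h hf yE] := in_adjoinP f_min (valP y); exists h => //.
rewrite (ext_degree_minimal_poly f_min) -ltnS prednK //.
by rewrite lt0n size_poly_eq0.
Qed.

(** On the right the extension and its center enter only through [deg a], which makes two extensions
    comparable. *)
Lemma adjoin_value_groupP u :
  u \in in_value_group (adjoin_valuation i w a) <->
  exists2 h : {poly K}, (size h <= deg a)%N & omega (tofrac h) = Fin u.
Proof.
split=> [/asboolP[y]|[h ha hu]].
  have [h ha yE] := adjoin_horner y; rewrite /= /adjoin_rat /= /adjoin_val yE.
  by rewrite valuation_horner_center //; exists h.
apply/asboolP; exists (Sub h^i.[a] (horner_in_adjoin i a h)).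
by rewrite /= /adjoin_rat /= valuation_horner_center.
Qed.

(** The set whose image is taken lies in the residue field of [omega] and depends only on [omega]
    and [deg a]. *)
Lemma adjoin_residue_fieldE : adjoin_residue_field i w a =
  residue_map w_ext @` [set residue omega (tofrac h) | h in
    [set h : {poly K} | (size h <= deg a)%N /\ Fin 0 <= omega (tofrac h)]].
Proof.
apply/seteqP; split=> [_ [r _ <-]|_ [_ [h [ha h_ge0] <-] <-]].
  rewrite -[r]residue_repr; move: (repr r) => x.
  have [h ha xE] := adjoin_horner (val x).
  have x_ge0 : Fin 0 <= adjoin_valuation i w a (val x) by apply: (valP x).
  have wx : adjoin_valuation i w a (val x) = omega (tofrac h).
    by rewrite /= /adjoin_rat /= /adjoin_val xE valuation_horner_center.
  exists (residue omega (tofrac h)); first by exists h => //; rewrite /= -wx.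
  rewrite residue_horner_center // -?wx //.
  by rewrite residue_mapE //; congr (residue w (ratC _)).
rewrite residue_horner_center //.
pose y : adjoin i a := Sub h^i.[a] (horner_in_adjoin i a h).
exists (residue (adjoin_valuation i w a) y) => //.
by rewrite residue_mapE /= /adjoin_rat /= // valuation_horner_center.
Qed.

End MinimalPair.

Theorem proposition4p2 (G : orderedZmodType)
    (K : fieldType) (Kbar : closedFieldType) (i : {rmorphism K -> Kbar})
    (Kbar_algebraic : forall z : Kbar, algebraicOver i z)
    (nu : valuation K G) (omega : valuation (ratfun K) G)
    (omega_nu : extends (@ratC K) nu omega)
    (omega_transcendental : valuation_transcendental omega_nu)
    (G_hull : is_divisible_hull omega)
    (omegab omegab' : valuation (ratfun Kbar) G)
    (omegab_ext : extends (ratmap i) omega omegab)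
    (omegab'_ext : extends (ratmap i) omega omegab')
    (a a' : Kbar) (gamma : G)
    (a_min : minimal_pair_of_definition omegab i a gamma)
    (a'_min : minimal_pair_of_definition omegab' i a' gamma) :
  [set: value_quotient (adjoin_valuation i omegab a) nu] #=
    [set: value_quotient (adjoin_valuation i omegab' a') nu] /\
  exists2 k : set (residue_field omega),
    residue_map omegab_ext @` k = adjoin_residue_field i omegab a &
    residue_map omegab'_ext @` k = adjoin_residue_field i omegab' a'.
Proof.
(* Each minimal pair bounds the degree of its center by that of the other. *)
have dE : ext_degree (adjoinC i a) = ext_degree (adjoinC i a').
  have [[_ a_mon] _] := a_min; have [[_ a'_mon] _] := a'_min.
  apply/eqP; rewrite eqn_leq.
  by rewrite (minimal_pair_degree_le Kbar_algebraic omegab'_ext omegab_ext a'_mon)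
    // (minimal_pair_degree_le Kbar_algebraic omegab_ext omegab'_ext a_mon).
split.
  (* The value groups contain one another; the two injections of quotients give equal cardinals. *)
  apply: Cantor_Bernstein; apply: card_value_quotient_le => u.
    move/(adjoin_value_groupP Kbar_algebraic omegab_ext a_min).
    by rewrite dE => /(adjoin_value_groupP Kbar_algebraic omegab'_ext a'_min).
  move/(adjoin_value_groupP Kbar_algebraic omegab'_ext a'_min).
  by rewrite -dE => /(adjoin_value_groupP Kbar_algebraic omegab_ext a_min).
(* The common subfield consists of the residues of the h(x) of value at least 0 with deg h < d. *)
exists [set residue omega (tofrac h) | h in [set h : {poly K} |
  (size h <= ext_degree (adjoinC i a))%N /\ Fin 0 <= omega (tofrac h)]].
  by rewrite (adjoin_residue_fieldE Kbar_algebraic omegab_ext a_min).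
by rewrite dE (adjoin_residue_fieldE Kbar_algebraic omegab'_ext a'_min).
Qed.
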